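(* Let $K$ be a group, let $(PQR): P\xrightarrow{\bar\jmath}Q\xrightarrow{\bar\phi}R$ be a group extension, and let $\theta:Q\to\mathrm{Out}(K)$ be an outer action. Let $(G,i,\pi)$ and $(G',i',\pi')$ be extensions of $K$ by $Q$ with the same outer action $\theta$ and with isomorphic $P$-subextensions $(KNP)=(N,i_0,\pi_0)$ and $(N',i_0',\pi_0')$ respectively; let $\varphi:N'\to N$ be such an isomorphism. Let $\Theta:Q\to\mathrm{Out}(N;K)$ and $\Theta':Q\to\mathrm{Out}(N';K)$ be the mod-$K$ outer actions induced by the conjugation actions of $G$ on $N$ and of $G'$ on $N'$ respectively, and let ${}^\varphi\Theta'(q):=\varphi\circ\Theta'(q)\circ\varphi^{-1}\in\mathrm{Out}(N;K)$ for $q\in Q$. Then $\Theta$ and ${}^\varphi\Theta'$ are $\mathrm{Aut}(KNP)$-conjugate if and only if there exists an iterated extension of $(KNP)$ by $(PQR)$ having $(G',i',\pi')$ as its $Q$-main extension and with $\Theta$ as its mod-$K$ outer action.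
   Context: Extensions. An extension of $K$ by $Q$ is $(G,i,\pi)$ with $i:K\to G$ an injective and $\pi:G\to Q$ a surjective homomorphism, $i(K)=\mathrm{Ker}(\pi)$; groups are identified with their images under the given injections. An isomorphism of extensions is a group isomorphism $\varphi:G_1\to G_2$ with $\varphi\circ i_1=i_2$, $\pi_2\circ\varphi=\pi_1$. Conjugation of $G$ on $K$ induces a homomorphism $Q\to\mathrm{Out}(K)=\mathrm{Aut}(K)/\mathrm{Inn}(K)$, the outer action. The $P$-subextension of $(G,i,\pi)$ is the extension $(N,i_0,\pi_0)$ of $K$ by $P$ with $N:=\pi^{-1}(P)$ (where $P$ is identified with $\bar\jmath(P)$) and $i_0,\pi_0$ induced by $i,\pi$. Iterated extensions. An iterated extension of $(KNP)$ by $(PQR)$ is $(G,j,\pi)$ with $G$ a group, $j:N\to G$ an injective and $\pi:G\to Q$ a surjective homomorphism such that, with $i:=j\circ i_0$ and $\phi:=\bar\phi\circ\pi$, $\pi\circ j=\bar\jmath\circ\pi_0$, $j(N)=\mathrm{Ker}(\phi)$ and $i(K)=\mathrm{Ker}(\pi)$. Its $Q$-main extension is $(G,i,\pi)$. Mod-$K$ outer actions. For a group $N$ with normal subgroup $K$, $\mathrm{Aut}_K(N)$ is the group of automorphisms of $N$ mapping $K$ onto $K$; $\mathrm{Out}(N;K):=\mathrm{Aut}_K(N)/\complement_N(K)$, with $\complement_N(K)$ the group of inner automorphisms of $N$ by elements of $K$. The mod-$K$ outer action of an iterated extension $(G,j,\pi)$ (in particular of $(G,j,\pi)$ with $j$ the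 inclusion of the $P$-subextension) is the homomorphism $Q\to\mathrm{Out}(N;K)$ sending $\pi(g)$ to the class of conjugation by $g\in G$ on $N$ (via $j$). $\mathrm{Aut}(KNP):=\{\eta\in\mathrm{Aut}(N):\eta\circ i_0=i_0,\ \pi_0\circ\eta=\pi_0\}$. Two homomorphisms $\Theta_1,\Theta_2:Q\to\mathrm{Out}(N;K)$ are $\mathrm{Aut}(KNP)$-conjugate iff there is $\eta\in\mathrm{Aut}(KNP)$, with image $\bar\eta$ in $\mathrm{Out}(N;K)$, such that $\Theta_2(q)=\bar\eta^{-1}\cdot\Theta_1(q)\cdot\bar\eta$ for all $q\in Q$. *)

(* Defs.v *)
From HB Require Import structures.
From mathcomp Require Import all_boot all_classical.

Set Implicit Arguments.
Unset Strict Implicit.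
Unset Printing Implicit Defensive.

Local Open Scope classical_set_scope.
Local Open Scope group_scope.

(* MathComp's groupType is a possibly infinite group. It carries a choiceType
   structure, which every type has classically (gen_choiceMixin). *)

Notation "{ 'ghom' G -> H }" := (UMagmaMorphism.type G H)
  (at level 0, G at level 98, H at level 99,
   format "{ 'ghom'  G  ->  H }") : type_scope.

Section GhomOf.
Variables (G H : groupType) (f : G -> H) (fM : {morph f : x y / x * y}).

Lemma ghom_of_subproof : monoid_morphism f.
Proof. by split=> //; apply: (@mulgI _ (f 1)); rewrite -fM !mulg1. Qed.

Definition ghom_fun of {morph f : x y / x * y} := f.

HB.instance Definition _ :=
  isUMagmaMorphism.Build G H (ghom_fun fM) ghom_of_subproof.

Definition ghom_of : {ghom G -> H} := ghom_fun fM.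

End GhomOf.

Section BijInv.
Variables (T U : Type) (f : T -> U) (fB : bijective f).

Lemma bij_inv_subproof : exists g, cancel f g /\ cancel g f.
Proof. by case: fB => g fK gK; exists g. Qed.

Definition bij_inv : U -> T := projT1 (cid bij_inv_subproof).

Lemma bij_invK : cancel f bij_inv.
Proof. by rewrite /bij_inv; case: cid => g []. Qed.

Lemma bij_invKV : cancel bij_inv f.
Proof. by rewrite /bij_inv; case: cid => g []. Qed.

End BijInv.

Section Subgroup.
Variables (G : groupType) (S : groupClosed G).

Definition subgroup_of := {x : G | x \in S}.

HB.instance Definition _ := SubChoice.on subgroup_of.

Definition subgroup_mk (x : G) (xS : x \in S) : subgroup_of := exist _ x xS.

Lemma subgroup_of_closed : group_closed (fun x => x \in S).
Proof. by split=> [|x y xS yS]; [apply: gpred1 | apply: gpredF]. Qed.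

HB.instance Definition _ :=
  SubChoice_isSubGroup.Build G _ subgroup_of subgroup_of_closed.

End Subgroup.

Section GroupClosedOf.
Variables (G : groupType) (S : {pred G}) (cS : group_closed S).

Definition closed_pred of group_closed S : {pred G} := S.

HB.instance Definition _ :=
  isMulClosed.Build G (closed_pred cS) (group_closedM cS).
HB.instance Definition _ := isMul1Closed.Build G (closed_pred cS) cS.1.
HB.instance Definition _ :=
  isInvClosed.Build G (closed_pred cS) (group_closedV cS).

Definition group_closed_of : groupClosed G := closed_pred cS.

End GroupClosedOf.

Record normal_subgroup (G : groupType) := NormalSubgroup {
  normal_sub :> groupClosed G;
  normalJ : forall x y, x \in normal_sub -> x ^ y \in normal_sub
}.

Section Quotient.
Variables (G : groupType) (H : normal_subgroup G).

Definition coset_rel (x y : G) := x^-1 * y \in H.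

Lemma coset_rel_refl : reflexive coset_rel.
Proof. by move=> x; rewrite /coset_rel mulVg gpred1. Qed.

Lemma coset_rel_sym : symmetric coset_rel.
Proof. by move=> x y; rewrite /coset_rel -gpredV invgM invgK. Qed.

Lemma coset_rel_trans : transitive coset_rel.
Proof.
move=> y x z xy yz; rewrite /coset_rel -[z](mulVKg y) mulgA.
exact: gpredM.
Qed.

Canonical coset_equiv :=
  EquivRel coset_rel coset_rel_refl coset_rel_sym coset_rel_trans.

Definition quotient := {eq_quot coset_equiv}%qT.
HB.instance Definition _ := Choice.on quotient.
HB.instance Definition _ := EqQuotient.on quotient.

Definition qclass (x : G) : quotient := \pi_quotient%qT x.

Lemma qclassP x y : qclass x = qclass y <-> x^-1 * y \in H.
Proof. by split=> [/eqmodP|h]; last exact/eqmodP. Qed.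

Lemma qclassS (c : quotient) : exists x, qclass x = c.
Proof. by exists (repr c); rewrite /qclass reprK. Qed.

Definition quotient_mul (c d : quotient) := qclass (repr c * repr d).
Definition quotient_inv (c : quotient) := qclass (repr c)^-1.

Lemma quotient_mulE x y : quotient_mul (qclass x) (qclass y) = qclass (x * y).
Proof.
apply/qclassP; set x' := repr _; set y' := repr _.
have hx : x'^-1 * x \in H by apply/qclassP; rewrite /qclass reprK.
have hy : y'^-1 * y \in H by apply/qclassP; rewrite /qclass reprK.
have -> : (x' * y')^-1 * (x * y) = (x'^-1 * x) ^ y' * (y'^-1 * y).
  by rewrite invgM /conjg !mulgA mulgK.
by rewrite gpredM // normalJ.
Qed.

Lemma quotient_invE x : quotient_inv (qclass x) = qclass x^-1.
Proof.
apply/qclassP; set x' := repr _.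
have hx : x^-1 * x' \in H by apply/qclassP; rewrite /qclass reprK.
by have := normalJ x^-1 hx; rewrite /conjg !invgK -mulgA mulVKg.
Qed.

Lemma quotient_mulA : associative quotient_mul.
Proof.
move=> c d e; have [x <-] := qclassS c.
have [y <-] := qclassS d; have [z <-] := qclassS e.
by rewrite !quotient_mulE mulgA.
Qed.

Lemma quotient_mul1 : left_id (qclass 1) quotient_mul.
Proof. by move=> c; have [x <-] := qclassS c; rewrite quotient_mulE mul1g. Qed.

Lemma quotient_mulg1 : right_id (qclass 1) quotient_mul.
Proof. by move=> c; have [x <-] := qclassS c; rewrite quotient_mulE mulg1. Qed.

Lemma quotient_mulV : left_inverse (qclass 1) quotient_inv quotient_mul.
Proof.
by move=> c; have [x <-] := qclassS c; rewrite quotient_invE quotient_mulE mulVg.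
Qed.

Lemma quotient_mulgV : right_inverse (qclass 1) quotient_inv quotient_mul.
Proof.
by move=> c; have [x <-] := qclassS c; rewrite quotient_invE quotient_mulE mulgV.
Qed.

HB.instance Definition _ := monoid.isMonoid.Build quotient
  quotient_mulA quotient_mul1 quotient_mulg1.
HB.instance Definition _ := hasInv.Build quotient quotient_inv.
HB.instance Definition _ :=
  Monoid_isGroup.Build quotient quotient_mulV quotient_mulgV.

Lemma qclassM : {morph qclass : x y / x * y}.
Proof. by move=> x y; rewrite [RHS]quotient_mulE. Qed.

Definition quotient_map : {ghom G -> quotient} := ghom_of qclassM.

Lemma quotient_mapS c : exists x, quotient_map x = c.
Proof. exact: qclassS. Qed.

Lemma quotient_map_eq1 x : quotient_map x = 1 <-> x \in H.
Proof. by split=> [/esym/qclassP|h]; [|apply/esym/qclassP]; rewrite invg1 mul1g. Qed.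

End Quotient.

Section Factor.
Variables (G Q H : groupType) (p : {ghom G -> Q}) (f : {ghom G -> H}).
Hypotheses (pS : forall q, exists g, p g = q)
  (fker : forall g, p g = 1 -> f g = 1).

Definition factor_fun (q : Q) : H := f (projT1 (cid (pS q))).

Lemma factor_funE g : factor_fun (p g) = f g.
Proof.
rewrite /factor_fun; case: cid => x /= px; apply: (@mulIg _ (f g)^-1).
by rewrite mulgV -gmulfF fker // gmulfF px mulgV.
Qed.

Lemma factor_funM : {morph factor_fun : x y / x * y}.
Proof.
move=> x y; have [g <-] := pS x; have [h <-] := pS y.
by rewrite -gmulfM !factor_funE gmulfM.
Qed.

Definition factor : {ghom Q -> H} := ghom_of factor_funM.

Lemma factorE g : factor (p g) = f g.
Proof. exact: factor_funE. Qed.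

End Factor.

(* Automorphisms multiply by composition, (a * b) x = a (b x), and a group acts
   by left conjugation x |-> g * x * g^-1, so that conjugation actions are
   homomorphisms for this product. *)
Record aut (G : groupType) := Aut {
  aut_fun :> {ghom G -> G};
  aut_bij : bijective aut_fun
}.

HB.instance Definition _ (G : groupType) := gen_eqMixin (aut G).
HB.instance Definition _ (G : groupType) := gen_choiceMixin (aut G).

Section AutGroup.
Variable G : groupType.
Implicit Types a b : aut G.

Lemma aut_eq a b : a =1 b -> a = b.
Proof.
case: a b => [[a [[a1] [aM]]] aB] [[b [[b1] [bM]]] bB] /= /funext ab.
move: a1 aM aB b1 bM bB; rewrite ab => a1 aM aB b1 bM bB.
by rewrite (Prop_irrelevance a1 b1) (Prop_irrelevance aM bM)
  (Prop_irrelevance aB bB).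
Qed.

Definition aut_mk (f : G -> G) (fM : {morph f : x y / x * y})
  (fB : bijective f) : aut G := @Aut G (ghom_of fM) fB.

Lemma aut_mul_morph a b : {morph a \o b : x y / x * y}.
Proof. by move=> x y /=; rewrite !gmulfM. Qed.

Definition aut_mul a b : aut G :=
  aut_mk (aut_mul_morph a b) (bij_comp (aut_bij a) (aut_bij b)).

Definition aut_one : aut G :=
  @aut_mk idfun (fun _ _ => erefl) (Bijective (fun=> erefl) (fun=> erefl)).

Lemma aut_inv_morph a : {morph bij_inv (aut_bij a) : x y / x * y}.
Proof.
move=> x y; apply: (bij_inj (aut_bij a)).
by rewrite gmulfM !bij_invKV.
Qed.

Definition aut_inv a : aut G :=
  aut_mk (@aut_inv_morph a)
    (Bijective (bij_invKV (aut_bij a)) (bij_invK (aut_bij a))).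

Lemma aut_mulA : associative aut_mul.
Proof. by move=> a b c; apply: aut_eq. Qed.

Lemma aut_mul1 : left_id aut_one aut_mul.
Proof. by move=> a; apply: aut_eq. Qed.

Lemma aut_mulg1 : right_id aut_one aut_mul.
Proof. by move=> a; apply: aut_eq. Qed.

Lemma aut_mulV : left_inverse aut_one aut_inv aut_mul.
Proof. by move=> a; apply: aut_eq => x; apply: bij_invK. Qed.

Lemma aut_mulgV : right_inverse aut_one aut_inv aut_mul.
Proof. by move=> a; apply: aut_eq => x; apply: bij_invKV. Qed.

HB.instance Definition _ := monoid.isMonoid.Build (aut G)
  aut_mulA aut_mul1 aut_mulg1.
HB.instance Definition _ := hasInv.Build (aut G) aut_inv.
HB.instance Definition _ := Monoid_isGroup.Build (aut G) aut_mulV aut_mulgV.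

Lemma autM a b x : (a * b) x = a (b x). Proof. by []. Qed.
Lemma aut1 x : (1 : aut G) x = x. Proof. by []. Qed.
Lemma autVK a : cancel a (a^-1)%g. Proof. exact: bij_invK. Qed.
Lemma autKV a : cancel (a^-1)%g a. Proof. exact: bij_invKV. Qed.

End AutGroup.

Section ConjAut.
Variables (A G : groupType) (f : {ghom A -> G}).
Hypotheses (f_inj : injective f)
  (fJ : forall g x, exists y, f y = g * f x * g^-1).

Definition conj_fun (g : G) (x : A) : A := projT1 (cid (fJ g x)).

Lemma conj_funE g x : f (conj_fun g x) = g * f x * g^-1.
Proof. by rewrite /conj_fun; case: cid. Qed.

Lemma conj_fun_morph g : {morph conj_fun g : x y / x * y}.
Proof.
by move=> x y; apply: f_inj; rewrite gmulfM !conj_funE gmulfM !mulgA mulgVK.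
Qed.

Lemma conj_fun_comp g h x : conj_fun g (conj_fun h x) = conj_fun (g * h) x.
Proof. by apply: f_inj; rewrite !conj_funE invgM !mulgA. Qed.

Lemma conj_fun1 x : conj_fun 1 x = x.
Proof. by apply: f_inj; rewrite conj_funE invg1 mulg1 mul1g. Qed.

Lemma conj_fun_bij g : bijective (conj_fun g).
Proof.
by exists (conj_fun g^-1) => x; rewrite conj_fun_comp ?mulVg ?mulgV conj_fun1.
Qed.

Definition conj_aut_fun g : aut A := aut_mk (conj_fun_morph g) (conj_fun_bij g).

Lemma conj_aut_morph : {morph conj_aut_fun : g h / g * h}.
Proof. by move=> g h; apply: aut_eq => x; rewrite autM [RHS]conj_fun_comp. Qed.

Definition conj_aut : {ghom G -> aut A} := ghom_of conj_aut_morph.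

Lemma conj_autE g x : f (conj_aut g x) = g * f x * g^-1.
Proof. exact: conj_funE. Qed.

End ConjAut.

Section Inner.
Variable G : groupType.

Definition inner : {ghom G -> aut G} :=
  @conj_aut G G idfun (fun _ _ => id) (fun g x => ex_intro _ _ erefl).

Lemma innerE g x : inner g x = g * x * g^-1.
Proof. exact: (@conj_autE G G idfun). Qed.

Lemma innerJ (a : aut G) g : inner g ^ a = inner ((a^-1)%g g).
Proof.
apply: aut_eq => x; rewrite /conjg !autM !innerE !gmulfM gmulfV.
by rewrite (autVK a).
Qed.

End Inner.

Section Out.
Variable K : groupType.

Definition inn_pred : {pred aut K} :=
  [pred a : aut K | `[< exists k, a = inner K k >]].

Lemma inn_closed : group_closed inn_pred.
Proof.
split=> [|a b /asboolP[k ->] /asboolP[l ->]]; apply/asboolP.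
  by exists 1; rewrite gmulf1.
by exists (k / l); rewrite gmulfF.
Qed.

Lemma inn_normal (a b : aut K) : a \in group_closed_of inn_closed ->
  a ^ b \in group_closed_of inn_closed.
Proof. by move=> /asboolP[k ->]; apply/asboolP; rewrite innerJ; eexists. Qed.

Definition Inn : normal_subgroup (aut K) := NormalSubgroup inn_normal.

Definition Out := quotient Inn.

End Out.

Section OutRel.
Variables (N : groupType) (K : normal_subgroup N).

Definition autK_pred : {pred aut N} :=
  [pred a : aut N | `[< a @` [set` K] = [set` K] >]].

Lemma autK_closed : group_closed autK_pred.
Proof.
split=> [|a b /asboolP aK /asboolP bK]; apply/asboolP; first exact: image_id.
have bVK : (b^-1)%g @` [set` K] = [set` K].
  rewrite -{1}bK image_comp -[RHS]image_id.
  by apply: eq_imagel => x _ /=; rewrite (autVK b).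
by rewrite -[RHS]aK -{2}bVK image_comp.
Qed.

Definition AutK := subgroup_of (group_closed_of autK_closed).

Lemma AutKP (a : AutK) x : x \in K -> val a x \in K.
Proof.
move=> xK; have /asboolP aK := valP a.
suff : [set` K] (val a x) by [].
by rewrite -aK; exists x.
Qed.

Definition innK_pred : {pred AutK} :=
  [pred a : AutK | `[< exists2 k, k \in K & val a = inner N k >]].

Lemma innK_closed : group_closed innK_pred.
Proof.
split=> [|a b /asboolP[k kK aE] /asboolP[l lK bE]]; apply/asboolP.
  by exists 1; rewrite ?gpred1 // gmulf1.
exists (k / l); first exact: gpredF.
by rewrite [RHS]gmulfF -aE -bE.
Qed.

Lemma innK_normal (a b : AutK) : a \in group_closed_of innK_closed ->
  a ^ b \in group_closed_of innK_closed.
Proof.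
move=> /asboolP[k kK aE]; apply/asboolP; exists (val b^-1 k).
  exact: AutKP.
by rewrite [LHS](_ : _ = val a ^ val b) // aE innerJ.
Qed.

Definition InnK : normal_subgroup AutK := NormalSubgroup innK_normal.

Definition OutK := quotient InnK.

End OutRel.

(* extension K G Q: an extension of K by Q with middle group G. *)
Record extension (K G Q : groupType) := Extension {
  ext_inj : {ghom K -> G};
  ext_proj : {ghom G -> Q};
  ext_injI : injective ext_inj;
  ext_projS : forall q, exists g, ext_proj g = q;
  ext_exact : range ext_inj = [set g | ext_proj g = 1]
}.
Arguments ext_injI {K G Q} e [x1 x2].

Record ext_iso (K G1 G2 Q : groupType)
    (E1 : extension K G1 Q) (E2 : extension K G2 Q) := ExtIso {
  iso_fun :> {ghom G1 -> G2};
  iso_bij : bijective iso_fun;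
  iso_inj : forall k, iso_fun (ext_inj E1 k) = ext_inj E2 k;
  iso_proj : forall g, ext_proj E2 (iso_fun g) = ext_proj E1 g
}.

Section ExtensionTheory.
Variables (K G Q : groupType) (E : extension K G Q).

Lemma ext_exactP g : (exists k, ext_inj E k = g) <-> ext_proj E g = 1.
Proof.
split=> [[k <-]|g1].
  have : range (ext_inj E) (ext_inj E k) by exists k.
  by rewrite ext_exact.
have : [set g | ext_proj E g = 1] g by [].
by rewrite -ext_exact => -[k _ kg]; exists k.
Qed.

Lemma ext_proj_inj k : ext_proj E (ext_inj E k) = 1.
Proof. by apply/ext_exactP; exists k. Qed.

Definition ext_ker_pred : {pred G} :=
  [pred g : G | `[< exists k, ext_inj E k = g >]].

Lemma ext_ker_closed : group_closed ext_ker_pred.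
Proof.
split=> [|x y /asboolP[k <-] /asboolP[l <-]]; apply/asboolP.
  by exists 1; rewrite gmulf1.
by exists (k / l); rewrite gmulfF.
Qed.

Lemma ext_kerP g : g \in group_closed_of ext_ker_closed <-> ext_proj E g = 1.
Proof.
by rewrite -ext_exactP; split=> [/asboolP|h]; last exact/asboolP.
Qed.

Lemma ext_ker_normal (x y : G) : x \in group_closed_of ext_ker_closed ->
  x ^ y \in group_closed_of ext_ker_closed.
Proof. by rewrite !ext_kerP gmulfJ => ->; rewrite conj1g. Qed.

(* The image of K, as a normal subgroup of G. *)
Definition ext_ker : normal_subgroup G := NormalSubgroup ext_ker_normal.

Lemma ext_injJ g k : exists l, ext_inj E l = g * ext_inj E k * g^-1.
Proof. by apply/ext_exactP; rewrite !gmulfM gmulfV ext_proj_inj mulg1 mulgV. Qed.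

(* The automorphism k |-> i^-1 (g * i k * g^-1) of K. *)
Definition ext_conj : {ghom G -> aut K} := conj_aut (ext_injI E) ext_injJ.

Lemma ext_conjE g k : ext_inj E (ext_conj g k) = g * ext_inj E k * g^-1.
Proof. exact: conj_autE. Qed.

Definition ext_conj_class : {ghom G -> Out K} :=
  [the {ghom G -> Out K} of quotient_map (Inn K) \o ext_conj].

Lemma ext_conj_class_ker g : ext_proj E g = 1 -> ext_conj_class g = 1.
Proof.
move=> /ext_exactP[k kg]; apply/quotient_map_eq1/asboolP; exists k.
apply: aut_eq => x; apply: (ext_injI E).
by rewrite ext_conjE innerE !gmulfM gmulfV -kg.
Qed.

Definition outer_action : {ghom Q -> Out K} :=
  factor (ext_projS E) ext_conj_class_ker.

Lemma outer_actionE g :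
  outer_action (ext_proj E g) = qclass (Inn K) (ext_conj g).
Proof. by rewrite /outer_action factorE. Qed.

End ExtensionTheory.

Record iterated_extension (K N P Q R G : groupType)
    (KNP : extension K N P) (PQR : extension P Q R) := IteratedExtension {
  iter_inj : {ghom N -> G};
  iter_proj : {ghom G -> Q};
  iter_injI : injective iter_inj;
  iter_projS : forall q, exists g, iter_proj g = q;
  iter_comm : forall n, iter_proj (iter_inj n) = ext_inj PQR (ext_proj KNP n);
  iter_exactN : range iter_inj = [set g | ext_proj PQR (iter_proj g) = 1];
  iter_exactK :
    range (iter_inj \o ext_inj KNP) = [set g | iter_proj g = 1]
}.
Arguments iter_injI {K N P Q R G KNP PQR} i [x1 x2].

Section IteratedExtensionTheory.
Variables (K N P Q R G : groupType).
Variables (KNP : extension K N P) (PQR : extension P Q R).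
Variable I : iterated_extension G KNP PQR.

Lemma main_extI :
  injective [the {ghom K -> G} of iter_inj I \o ext_inj KNP].
Proof. exact: inj_comp (iter_injI I) (ext_injI KNP). Qed.

Definition main_ext : extension K G Q :=
  Extension main_extI (iter_projS I) (iter_exactK I).

Lemma iter_exactNP g :
  (exists n, iter_inj I n = g) <-> ext_proj PQR (iter_proj I g) = 1.
Proof.
split=> [[n <-]|g1]; first by rewrite iter_comm ext_proj_inj.
have : [set g | ext_proj PQR (iter_proj I g) = 1] g by [].
by rewrite -iter_exactN => -[n _ ng]; exists n.
Qed.

Lemma iter_injJ g n : exists m, iter_inj I m = g * iter_inj I n * g^-1.
Proof.
apply/iter_exactNP; rewrite !gmulfM !gmulfV iter_comm ext_proj_inj.
by rewrite mulg1 mulgV.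
Qed.

(* The automorphism n |-> j^-1 (g * j n * g^-1) of N. *)
Definition iter_conj : {ghom G -> aut N} := conj_aut (iter_injI I) iter_injJ.

Lemma iter_conjE g n : iter_inj I (iter_conj g n) = g * iter_inj I n * g^-1.
Proof. exact: conj_autE. Qed.

Lemma iter_kerP n : n \in ext_ker KNP <-> iter_proj I (iter_inj I n) = 1.
Proof.
rewrite iter_comm; split=> [/ext_kerP->|h]; first by rewrite gmulf1.
by apply/ext_kerP/(ext_injI PQR); rewrite gmulf1.
Qed.

Lemma iter_conj_ker g n : n \in ext_ker KNP -> iter_conj g n \in ext_ker KNP.
Proof.
rewrite !iter_kerP iter_conjE !gmulfM gmulfV => ->.
by rewrite mulg1 mulgV.
Qed.

Lemma iter_conj_autK g :
  iter_conj g \in group_closed_of (autK_closed (ext_ker KNP)).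
Proof.
apply/asboolP; apply/seteqP; split=> [_ [n nK <-]|n nK].
  exact: iter_conj_ker.
exists (iter_conj g^-1 n); first exact: iter_conj_ker.
by rewrite gmulfV (autKV (iter_conj g)).
Qed.

Definition iter_conjK_fun g : AutK (ext_ker KNP) := subgroup_mk (iter_conj_autK g).

Lemma iter_conjK_morph : {morph iter_conjK_fun : g h / g * h}.
Proof. by move=> g h; apply: val_inj; rewrite /= gmulfM. Qed.

Definition iter_conjK : {ghom G -> AutK (ext_ker KNP)} :=
  ghom_of iter_conjK_morph.

Definition iter_conj_class : {ghom G -> OutK (ext_ker KNP)} :=
  [the {ghom G -> OutK (ext_ker KNP)} of
    quotient_map (InnK (ext_ker KNP)) \o iter_conjK].

Lemma iter_conj_class_ker g : iter_proj I g = 1 -> iter_conj_class g = 1.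
Proof.
move=> g1; apply/quotient_map_eq1/asboolP.
have [k kg] : exists k, ext_inj main_ext k = g by apply/ext_exactP.
exists (ext_inj KNP k); first by apply/asboolP; exists k.
apply: aut_eq => n; apply: (iter_injI I).
by rewrite iter_conjE innerE !gmulfM gmulfV -kg.
Qed.

Definition modK_outer_action : {ghom Q -> OutK (ext_ker KNP)} :=
  factor (iter_projS I) iter_conj_class_ker.

Lemma modK_outer_actionE g :
  modK_outer_action (iter_proj I g) = qclass (InnK (ext_ker KNP)) (iter_conjK g).
Proof. by rewrite /modK_outer_action factorE. Qed.

End IteratedExtensionTheory.

(* The P-subextension, with middle group the subgroup p^-1(P) of G, and the
   iterated extension given by the inclusion of this subgroup. *)
Section SubExtension.
Variables (K G P Q R : groupType).
Variables (E : extension K G Q) (PQR : extension P Q R).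

Definition subext_pred : {pred G} :=
  [pred g : G | `[< exists p, ext_inj PQR p = ext_proj E g >]].

Lemma subext_closed : group_closed subext_pred.
Proof.
split=> [|x y /asboolP[p px] /asboolP[q qy]]; apply/asboolP.
  by exists 1; rewrite !gmulf1.
by exists (p / q); rewrite !gmulfF px qy.
Qed.

Definition subext_group := subgroup_of (group_closed_of subext_closed).

Lemma subext_incl_morph : {morph (val : subext_group -> G) : x y / x * y}.
Proof. by []. Qed.

Definition subext_incl : {ghom subext_group -> G} := ghom_of subext_incl_morph.

Lemma subext_inj_subproof k : ext_inj E k \in group_closed_of subext_closed.
Proof. by apply/asboolP; exists 1; rewrite gmulf1 ext_proj_inj. Qed.

Definition subext_inj_fun k : subext_group := subgroup_mk (subext_inj_subproof k).

Lemma subext_inj_morph : {morph subext_inj_fun : x y / x * y}.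
Proof. by move=> x y; apply: val_inj; rewrite /= gmulfM. Qed.

Definition subext_inj : {ghom K -> subext_group} := ghom_of subext_inj_morph.

Lemma subext_proj_subproof (n : subext_group) :
  exists p, ext_inj PQR p = ext_proj E (val n).
Proof. exact/asboolP/(valP n). Qed.

Definition subext_proj_fun n : P := projT1 (cid (subext_proj_subproof n)).

Lemma subext_proj_funE n :
  ext_inj PQR (subext_proj_fun n) = ext_proj E (val n).
Proof. by rewrite /subext_proj_fun; case: cid. Qed.

Lemma subext_proj_morph : {morph subext_proj_fun : x y / x * y}.
Proof.
move=> x y; apply: (ext_injI PQR).
by rewrite gmulfM !subext_proj_funE -gmulfM.
Qed.

Definition subext_proj : {ghom subext_group -> P} := ghom_of subext_proj_morph.

Lemma subext_projE n : ext_inj PQR (subext_proj n) = ext_proj E (val n).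
Proof. exact: subext_proj_funE. Qed.

Lemma subext_injI : injective subext_inj.
Proof. by move=> x y /(congr1 val) /(ext_injI E). Qed.

Lemma subext_projS p : exists n, subext_proj n = p.
Proof.
have [g gp] := ext_projS E (ext_inj PQR p).
have gN : g \in group_closed_of subext_closed by apply/asboolP; exists p.
by exists (subgroup_mk gN); apply: (ext_injI PQR); rewrite subext_projE.
Qed.

Lemma subext_exact : range subext_inj = [set n | subext_proj n = 1].
Proof.
apply/seteqP; split=> [_ [k _ <-]|n /= n1].
  by apply: (ext_injI PQR); rewrite subext_projE ext_proj_inj gmulf1.
have /ext_exactP[k kn] : ext_proj E (val n) = 1.
  by rewrite -subext_projE [subext_proj n]n1 gmulf1.
by exists k => //; apply: val_inj.
Qed.

Definition subext : extension K subext_group P :=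
  Extension subext_injI subext_projS subext_exact.

Lemma subext_iter_exactN :
  range subext_incl = [set g | ext_proj PQR (ext_proj E g) = 1].
Proof.
apply/seteqP; split=> [_ [n _ <-]|g /= /ext_exactP[p pg]].
  by apply/ext_exactP; exists (subext_proj n); rewrite subext_projE.
have gN : g \in group_closed_of subext_closed by apply/asboolP; exists p.
by exists (subgroup_mk gN).
Qed.

Definition subext_iter : iterated_extension G subext PQR :=
  @IteratedExtension _ _ _ _ _ _ subext PQR subext_incl (ext_proj E)
    val_inj (ext_projS E) (fun n => esym (subext_projE n))
    subext_iter_exactN (ext_exact E).

End SubExtension.

Record ext_aut (K N P : groupType) (KNP : extension K N P) := ExtAut {
  ext_aut_fun :> aut N;
  ext_aut_inj : forall k, ext_aut_fun (ext_inj KNP k) = ext_inj KNP k;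
  ext_aut_proj : forall n, ext_proj KNP (ext_aut_fun n) = ext_proj KNP n
}.

Section Conjugate.
Variables (K N P Q : groupType) (KNP : extension K N P).

Lemma ext_aut_autK (eta : ext_aut KNP) :
  (eta : aut N) \in group_closed_of (autK_closed (ext_ker KNP)).
Proof.
apply/asboolP; apply/seteqP; split=> [_ [n nK <-]|n nK].
  by have /asboolP[k <-] := nK; apply/asboolP; exists k; rewrite ext_aut_inj.
by exists n => //; have /asboolP[k <-] := nK; rewrite ext_aut_inj.
Qed.

Definition ext_aut_class (eta : ext_aut KNP) : OutK (ext_ker KNP) :=
  qclass (InnK (ext_ker KNP)) (subgroup_mk (ext_aut_autK eta)).

Definition ext_aut_conjugate (T1 T2 : {ghom Q -> OutK (ext_ker KNP)}) : Prop :=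
  exists eta : ext_aut KNP, forall q : Q,
    T2 q = (ext_aut_class eta)^-1 * T1 q * ext_aut_class eta.

End Conjugate.

(* The homomorphism Out(N';K) -> Out(N;K), a |-> phi \o a \o phi^-1. *)
Section Transport.
Variables (K N' N P : groupType).
Variables (E' : extension K N' P) (E : extension K N P) (phi : ext_iso E' E).

Let phiV := bij_inv (iso_bij phi).

Lemma transport_morph (a : aut N') : {morph phi \o a \o phiV : x y / x * y}.
Proof.
move=> x y /=; have -> : phiV (x * y) = phiV x * phiV y.
  by apply: (bij_inj (iso_bij phi)); rewrite gmulfM !bij_invKV.
by rewrite !gmulfM.
Qed.

Lemma transport_bij (a : aut N') : bijective (phi \o a \o phiV).
Proof.
apply: bij_comp (bij_comp (iso_bij phi) (aut_bij a)) _.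
exact: Bijective (bij_invKV (iso_bij phi)) (bij_invK (iso_bij phi)).
Qed.

Definition transport_aut (a : aut N') : aut N :=
  aut_mk (transport_morph a) (transport_bij a).

Lemma transport_autE a n : transport_aut a n = phi (a (phiV n)).
Proof. by []. Qed.

Lemma transport_ker n : phi n \in ext_ker E <-> n \in ext_ker E'.
Proof. by rewrite !ext_kerP iso_proj. Qed.

Lemma transport_autK (a : AutK (ext_ker E')) :
  transport_aut (val a) \in group_closed_of (autK_closed (ext_ker E)).
Proof.
have phiVK := bij_invKV (iso_bij phi).
have inK (b : AutK (ext_ker E')) n : n \in ext_ker E ->
    transport_aut (val b) n \in ext_ker E.
  by move=> nK; apply/transport_ker/AutKP/transport_ker; rewrite phiVK.
apply/asboolP; apply/seteqP; split=> [_ [n nK <-]|n nK]; first exact: inK.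
exists (transport_aut (val a^-1) n); first exact: inK.
rewrite !transport_autE /phiV bij_invK.
by rewrite [X in phi X](autKV (val a)) phiVK.
Qed.

Definition transport_autK_fun (a : AutK (ext_ker E')) : AutK (ext_ker E) :=
  subgroup_mk (transport_autK a).

Lemma transport_autK_morph : {morph transport_autK_fun : a b / a * b}.
Proof.
move=> a b; apply/val_inj/aut_eq => n.
rewrite -[RHS]/(phi (val a (phiV (phi (val b (phiV n)))))).
by rewrite /phiV bij_invK.
Qed.

Definition transport_class :
    {ghom AutK (ext_ker E') -> OutK (ext_ker E)} :=
  [the {ghom _ -> OutK (ext_ker E)} of
    quotient_map (InnK (ext_ker E)) \o ghom_of transport_autK_morph].

Lemma transport_class_ker a :
  quotient_map (InnK (ext_ker E')) a = 1 -> transport_class a = 1.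
Proof.
move=> /quotient_map_eq1/asboolP[k kK ak]; apply/quotient_map_eq1/asboolP.
exists (phi k); first exact/transport_ker.
apply: aut_eq => n; rewrite innerE [LHS]transport_autE ak innerE.
by rewrite !gmulfM gmulfV /phiV bij_invKV.
Qed.

Definition transport : {ghom OutK (ext_ker E') -> OutK (ext_ker E)} :=
  factor (@quotient_mapS _ (InnK (ext_ker E'))) transport_class_ker.

Lemma transportE a : transport (qclass (InnK (ext_ker E')) a) =
  qclass (InnK (ext_ker E)) (transport_autK_fun a).
Proof. by rewrite /transport -[qclass (InnK (ext_ker E')) a]/(quotient_map _ a) factorE. Qed.

End Transport.

(* Equality of two extensions with the same middle group. *)
Definition same_ext (K G Q : groupType) (E1 E2 : extension K G Q) : Prop :=
  ext_inj E1 =1 ext_inj E2 /\ ext_proj E1 =1 ext_proj E2.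

Section TransportAction.
Variables (K N' N P Q : groupType).
Variables (E' : extension K N' P) (E : extension K N P) (phi : ext_iso E' E).
Variable T : {ghom Q -> OutK (ext_ker E')}.

Definition transport_action : {ghom Q -> OutK (ext_ker E)} :=
  [the {ghom Q -> OutK (ext_ker E)} of transport phi \o T].

End TransportAction.

(* Main.v *)
Require Import Defs.
From mathcomp Require Import all_boot all_classical.

(** An iterated extension of (KNP) by (PQR) with main extension (G', i', pi')
    is nothing but an identification of N with the P-subextension N' of G'.
    Transporting the inclusion of N' in G' along an isomorphism
    psi : N' -> N of extensions of K by P gives such an iterated extension
    ([iterated_push]).  Conversely, in any such iterated extension N and N' have
    the same image in G', so that comparing the two embeddings gives back
    psi ([iterated_compare]).  In this correspondence the mod-K outer action
    of the iterated extension is the transport along psi of the mod-K outer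
    action Theta' on N' ([modK_outer_action_transport]), because both come from
    conjugation by the same elements of G'.

    Now fix one isomorphism phi : N' -> N.  All the others are the composites
    eta \o phi with eta in Aut(KNP) ([ext_iso_torsor]), and transporting along
    eta \o phi amounts to transporting along phi and then conjugating by the class
    of eta ([transport_class_comp]).  So Theta is the outer action of an
    iterated extension with main extension G' if and only if it is
    eta * (transport of Theta' along phi) * eta^-1 for some eta, which is
    the asserted conjugacy. *)

Set Implicit Arguments.
Unset Strict Implicit.
Unset Printing Implicit Defensive.

(** * Isomorphisms of extensions *)

Section IsoTorsor.
Local Open Scope group_scope.
Variables (K N' N P : groupType).
Variables (E' : extension K N' P) (E : extension K N P).

Lemma iso_comp_autM (phi : ext_iso E' E) (eta : aut N) :
  {morph eta \o phi : x y / x * y}.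
Proof. by move=> x y; rewrite /= !gmulfM. Qed.

Lemma iso_comp_aut_inj (phi : ext_iso E' E) (eta : ext_aut E) k :
  (eta \o phi) (ext_inj E' k) = ext_inj E k.
Proof. by rewrite /= iso_inj ext_aut_inj. Qed.

Lemma iso_comp_aut_proj (phi : ext_iso E' E) (eta : ext_aut E) n :
  ext_proj E ((eta \o phi) n) = ext_proj E' n.
Proof. by rewrite /= ext_aut_proj iso_proj. Qed.

Definition iso_comp_aut (phi : ext_iso E' E) (eta : ext_aut E) :
    ext_iso E' E :=
  @ExtIso _ _ _ _ E' E (ghom_of (iso_comp_autM phi eta))
    (bij_comp (aut_bij eta) (iso_bij phi))
    (iso_comp_aut_inj phi eta) (iso_comp_aut_proj phi eta).

Lemma iso_divM (phi psi : ext_iso E' E) :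
  {morph psi \o bij_inv (iso_bij phi) : x y / x * y}.
Proof.
move=> x y; rewrite /= -gmulfM; congr (psi _).
by apply: (bij_inj (iso_bij phi)); rewrite gmulfM !bij_invKV.
Qed.

Lemma iso_div_bij (phi psi : ext_iso E' E) :
  bijective (psi \o bij_inv (iso_bij phi)).
Proof.
apply: bij_comp (iso_bij psi) _.
by exists phi; [apply: bij_invKV | apply: bij_invK].
Qed.

Lemma iso_div_inj (phi psi : ext_iso E' E) k :
  aut_mk (iso_divM phi psi) (iso_div_bij phi psi) (ext_inj E k) = ext_inj E k.
Proof.
rewrite -[LHS]/(psi (bij_inv (iso_bij phi) (ext_inj E k))).
by rewrite -{1}(iso_inj phi) bij_invK iso_inj.
Qed.

Lemma iso_div_proj (phi psi : ext_iso E' E) n :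
  ext_proj E (aut_mk (iso_divM phi psi) (iso_div_bij phi psi) n) = ext_proj E n.
Proof.
rewrite -[LHS]/(ext_proj E (psi (bij_inv (iso_bij phi) n))).
by rewrite iso_proj -(iso_proj phi) bij_invKV.
Qed.

Definition iso_div (phi psi : ext_iso E' E) : ext_aut E :=
  ExtAut (iso_div_inj phi psi) (iso_div_proj phi psi).

Lemma ext_iso_torsor (phi psi : ext_iso E' E) :
  exists eta : ext_aut E, psi =1 iso_comp_aut phi eta.
Proof.
exists (iso_div phi psi) => n.
by rewrite -[RHS]/(psi (bij_inv (iso_bij phi) (phi n))) bij_invK.
Qed.

Lemma eq_transport (phi psi : ext_iso E' E) :
  phi =1 psi -> transport phi =1 transport psi.
Proof.
move=> phi_psi c; have [a <-] := qclassS c; rewrite !transportE.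
congr (qclass _ _); apply/val_inj/aut_eq => n.
rewrite !transport_autE phi_psi; congr (psi (val a _)).
by apply: (bij_inj (iso_bij psi)); rewrite -{1}phi_psi !bij_invKV.
Qed.

(** At the level of automorphisms, this is
    (eta \o phi) \o a \o (eta \o phi)^-1 = eta \o (phi \o a \o phi^-1) \o eta^-1. *)
Lemma transport_class_comp (phi : ext_iso E' E) (eta : ext_aut E) c :
  transport (iso_comp_aut phi eta) c =
    ext_aut_class eta * transport phi c * (ext_aut_class eta)^-1.
Proof.
have [a <-] := qclassS c; apply: (canRL (mulgK _)).
rewrite !transportE -!qclassM; congr (qclass _ _); apply/val_inj/aut_eq => n.
set psi := iso_comp_aut phi eta.
have -> : n = phi (bij_inv (iso_bij phi) n) by rewrite bij_invKV.
set m := bij_inv _ n.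
rewrite -[LHS]/(psi (val a (bij_inv (iso_bij psi) (psi m)))).
rewrite -[RHS]/(eta (phi (val a (bij_inv (iso_bij phi) (phi m))))).
by rewrite !bij_invK.
Qed.

End IsoTorsor.

(** * Iterated extensions with a given main extension *)

Section Iterated.
Local Open Scope classical_set_scope.
Local Open Scope group_scope.
Variables (K N' N P Q R G : groupType) (PQR : extension P Q R).
Variables (E' : extension K N' P) (E : extension K N P).

Section Push.
Variables (I' : iterated_extension G E' PQR) (psi : ext_iso E' E).
Let psiV := bij_inv (iso_bij psi).
Let psiK : cancel psi psiV := bij_invK (iso_bij psi).
Let psiVK : cancel psiV psi := bij_invKV (iso_bij psi).

Lemma push_injM : {morph iter_inj I' \o psiV : x y / x * y}.
Proof.
move=> x y; rewrite /= -gmulfM; congr (iter_inj I' _).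
by apply: (bij_inj (iso_bij psi)); rewrite gmulfM !psiVK.
Qed.

Lemma push_injI : injective (ghom_of push_injM).
Proof. exact: inj_comp (iter_injI I') (can_inj psiVK). Qed.

Lemma push_comm n :
  iter_proj I' (ghom_of push_injM n) = ext_inj PQR (ext_proj E n).
Proof.
rewrite -[ghom_of _ n]/(iter_inj I' (psiV n)) iter_comm.
by rewrite -(iso_proj psi) psiVK.
Qed.

Lemma push_exactN : range (ghom_of push_injM) =
  [set g | ext_proj PQR (iter_proj I' g) = 1].
Proof.
rewrite -(iter_exactN I'); apply/seteqP; split=> [_ [n _ <-]|_ [n _ <-]].
  by exists (psiV n).
by exists (psi n) => //; congr (iter_inj I' _); apply: psiK.
Qed.

Lemma push_exactK : range (ghom_of push_injM \o ext_inj E) =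
  [set g | iter_proj I' g = 1].
Proof.
rewrite -(iter_exactK I'); apply: eq_imagel => k _ /=.
by congr (iter_inj I' _); rewrite -(iso_inj psi) psiK.
Qed.

Lemma iterated_push : exists I : iterated_extension G E PQR,
  (forall n, iter_inj I (psi n) = iter_inj I' n) /\ iter_proj I =1 iter_proj I'.
Proof.
exists (IteratedExtension push_injI (iter_projS I') push_comm
  push_exactN push_exactK).
by split=> // n; rewrite -[LHS]/(iter_inj I' (psiV (psi n))) psiK.
Qed.

End Push.

(** Both embeddings have the image Ker(G -> R), so each element of N' has a
    unique partner in N with the same image in G. *)
Lemma iterated_compare (I' : iterated_extension G E' PQR)
    (I : iterated_extension G E PQR) :
    same_ext (main_ext I) (main_ext I') ->
  exists psi : ext_iso E' E, forall n, iter_inj I (psi n) = iter_inj I' n.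
Proof.
case=> eq_inj eq_proj.
have partner n : exists m, iter_inj I m = iter_inj I' n.
  apply/iter_exactNP; rewrite [iter_proj I _]eq_proj.
  by apply/(iter_exactNP I'); exists n.
have partner' m : exists n, iter_inj I' n = iter_inj I m.
  apply/iter_exactNP; rewrite -[iter_proj I' _]eq_proj.
  by apply/(iter_exactNP I); exists m.
pose f n := projT1 (cid (partner n)).
have fE n : iter_inj I (f n) = iter_inj I' n by rewrite /f; case: cid.
pose g m := projT1 (cid (partner' m)).
have gE m : iter_inj I' (g m) = iter_inj I m by rewrite /g; case: cid.
have fM : {morph f : x y / x * y}.
  by move=> x y; apply: (iter_injI I); rewrite gmulfM !fE gmulfM.
have fB : bijective (ghom_of fM).
  exists g => n; first by apply: (iter_injI I'); rewrite gE; apply: fE.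
  by apply: (iter_injI I); rewrite -[RHS]gE; apply: fE.
have f_inj k : ghom_of fM (ext_inj E' k) = ext_inj E k.
  by apply: (iter_injI I); rewrite [LHS]fE; apply/esym/(eq_inj k).
have f_proj n : ext_proj E (ghom_of fM n) = ext_proj E' n.
  apply: (ext_injI PQR); rewrite -(iter_comm I) -(iter_comm I').
  by rewrite [iter_proj I _]eq_proj; congr (iter_proj I' _); apply: fE.
by exists (ExtIso fB f_inj f_proj).
Qed.

(** Under the identification psi, conjugation by g in G is the same
    automorphism on both sides. *)
Lemma modK_outer_action_transport (I' : iterated_extension G E' PQR)
    (I : iterated_extension G E PQR) (psi : ext_iso E' E) :
    (forall n, iter_inj I (psi n) = iter_inj I' n) ->
    iter_proj I =1 iter_proj I' ->
  modK_outer_action I =1 transport_action psi (modK_outer_action I').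
Proof.
move=> eq_inj eq_proj q; have [g <-] := iter_projS I' q.
rewrite -[RHS]/(transport psi _) modK_outer_actionE transportE.
rewrite -[in LHS]eq_proj modK_outer_actionE.
congr (qclass _ _); apply/val_inj/aut_eq => n; apply: (iter_injI I).
rewrite [LHS]iter_conjE transport_autE eq_inj [RHS]iter_conjE -eq_inj.
by rewrite bij_invKV.
Qed.

End Iterated.

(** * The conjugacy criterion *)

Theorem proposition16p9 (K P Q R : groupType) (PQR : extension P Q R)
    (theta : {ghom Q -> Out K})
    (G G' : groupType) (E : extension K G Q) (E' : extension K G' Q)
    (hE : outer_action E =1 theta) (hE' : outer_action E' =1 theta)
    (phi : ext_iso (subext E' PQR) (subext E PQR)) :
  let KNP := subext E PQR in
  let Theta := modK_outer_action (subext_iter E PQR) in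
  let Theta' := modK_outer_action (subext_iter E' PQR) in
  ext_aut_conjugate Theta (transport_action phi Theta') <->
  exists I : iterated_extension G' KNP PQR,
    same_ext (main_ext I) E' /\ modK_outer_action I =1 Theta.
Proof.
move=> KNP Theta Theta'.
have conjE (eta : ext_aut KNP) q :
    transport_action (iso_comp_aut phi eta) Theta' q = Theta q <->
    transport_action phi Theta' q =
      ((ext_aut_class eta)^-1 * Theta q * ext_aut_class eta)%g.
  rewrite [transport_action (iso_comp_aut _ _) _ _]transport_class_comp.
  rewrite -[transport phi _]/(transport_action phi Theta' q).
  by split=> [<-|->]; rewrite !mulgA ?mulVg ?mulgV mul1g ?mulgVK ?mulgK.
split=> [[eta etaE]|[I [sameI actI]]].
  have [I [injI projI]] :=
    iterated_push (subext_iter E' PQR) (iso_comp_aut phi eta).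
  exists I; split.
    split=> [k|g]; last exact: projI.
    rewrite -[LHS]/(iter_inj I (ext_inj KNP k)).
    by rewrite -(iso_inj (iso_comp_aut phi eta)) injI.
  move=> q; rewrite (modK_outer_action_transport injI projI).
  exact/conjE/etaE.
(* E' and the main extension of subext_iter E' PQR differ only in their proof
   components: the underlying maps are convertible. *)
have sameI' : same_ext (main_ext I) (main_ext (subext_iter E' PQR)).
  by case: sameI => eq_inj eq_proj; split.
have [psi psiE] := iterated_compare sameI'.
have [eta etaE] := ext_iso_torsor phi psi.
exists eta => q; apply/conjE; rewrite -actI.
rewrite (modK_outer_action_transport psiE sameI.2).
exact/esym/eq_transport.
Qed.
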